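(* Let $(\mathfrak{Z},\zeta)$ be the locally finite metric space $\mathfrak{Z}=\coprod_{n\in 2\mathbb{N}}\mathsf{M}_n$ (the disjoint union, over all positive even integers $n$, of the finite metric spaces $(\mathsf{M}_n,d_\infty)$ described in the context), with metric $\zeta$ such that $\zeta$ restricted to any $\mathsf{M}_n$ is the original metric $d_\infty$ on $\mathsf{M}_n$, and such that $\zeta(x,y)=4^{m+n}$ if $x\in\mathsf{M}_m$ and $y\in\mathsf{M}_n$ with $m\neq n$. Then $(\mathfrak{Z},\zeta)$ does not uniformly embed into any metric space of non zero generalized roundness; that is, if $(B,d)$ is a metric space with $\mathfrak{q}(B)>0$ (possibly $\mathfrak{q}(B)=\infty$), then there is no uniform embedding $f:\mathfrak{Z}\to B$.
   Context: For a positive even integer $n$, $\mathsf{L}_n=\{k n^{-n}: k\in\mathbb{Z},\ 1\leq k\leq n^{2n}\}$ with the cyclic metric $\chi(x,y)=\min\{|x-y|,\,n^n-|x-y|\}$. $\mathsf{M}_n=\prod_{i=1}^{n^n}\mathsf{L}_n$ with the metric $d_\infty(x,y)=\max_{1\leq i\leq n^n}\chi(x_i,y_i)$. A metric space is locally finite if every ball of finite radius is a finite set. The generalized roundness $\mathfrak{q}(X)\in[0,\infty]$ of a metric space $(X,d)$ is the supremum of the set of all $p\geq 0$ such that for all integers $n\geq 2$ and all (not necessarily distinct) points $x_1,\dots,x_n,y_1,\dots,y_n\in X$, $$\sum_{1\leq i<j\leq n}\{d(x_i,x_j)^p+d(y_i,y_j)^p\}\leq\sum_{1\leq i,j\leq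 n}d(x_i,y_j)^p.$$ A uniform embedding of $(X,d)$ into $(Y,\varsigma)$ is an injection $f:X\to Y$ such that both $f$ and $f^{-1}:f(X)\to X$ are uniformly continuous, where $f(X)$ carries the metric induced by $\varsigma$.
   Formalization: The given ζ is not a metric: M_8 has points at distance 2^23, but each is at distance 4^10 = 2^20 from M_2. The formal theorem keeps ζ as given, drops the claim that it is a (locally finite) metric, and reads uniform embedding by the usual epsilon-delta condition for ζ. *)

(* Defs.v *)
From HB Require Import structures.
From mathcomp Require Import all_boot all_order all_algebra.
From mathcomp Require Import all_classical all_reals all_analysis.

Set Implicit Arguments.
Unset Strict Implicit.
Unset Printing Implicit Defensive.

Import Order.TTheory GRing.Theory Num.Theory.

Local Open Scope classical_set_scope.
Local Open Scope ring_scope.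

Section distance.
Context {R : realType}.

(* Since the function [zeta] below violates the triangle inequality, the next
   notions are stated for an arbitrary two-variable function in place of a
   metric. *)

Definition dist_unif_continuous (X Y : Type) (dX : X -> X -> R)
    (dY : Y -> Y -> R) (f : X -> Y) : Prop :=
  forall e : R, 0 < e -> exists2 d : R, 0 < d &
    forall x x' : X, dX x x' < d -> dY (f x) (f x') < e.

(* [g] is the inverse of [f] on its range, which carries the restriction of
   [dY]. *)
Definition uniform_embedding (X Y : Type) (dX : X -> X -> R)
    (dY : Y -> Y -> R) (f : X -> Y) : Prop :=
  [/\ injective f,
      dist_unif_continuous dX dY f &
      exists2 g : range f -> X,
        (forall y : range f, f (g y) = val y) &
        dist_unif_continuous (fun y y' : range f => dY (val y) (val y')) dX g].

(* Here 0 `^ 0 = 1, so that p = 0 always belongs to the set of exponents; the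
   supremum in [0, +oo] does not depend on this convention. *)
Definition generalized_roundness (X : Type) (d : X -> X -> R) : \bar R :=
  ereal_sup [set p%:E | p in [set p : R | 0 <= p /\
    forall (n : nat) (x y : 'I_n -> X), (2 <= n)%N ->
      \sum_(i < n) \sum_(j < n | (i < j)%N)
         (d (x i) (x j) `^ p + d (y i) (y j) `^ p)
      <= \sum_(i < n) \sum_(j < n) d (x i) (y j) `^ p]].

End distance.

Section enflo.
Variable R : realType.

Definition Lset (n : nat) : set R :=
  [set x | exists k : int,
     [/\ 1 <= k, k <= (n ^ (2 * n))%N%:Z & x = k%:~R * n%:R ^- n]].

Definition chi (n : nat) (x y : R) : R :=
  Num.min `|x - y| (n%:R ^+ n - `|x - y|).

Definition Mspace (n : nat) : Type := {ffun 'I_(n ^ n)%N -> Lset n}.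

(* The values of [chi] on [Lset n] are nonnegative, so that 0 is a neutral
   initial value for the maximum. *)
Definition dinf (n : nat) (x y : Mspace n) : R :=
  \big[Num.max/0]_(i < (n ^ n)%N) chi n (val (x i)) (val (y i)).

Definition pos_even : Type := {n : nat | (0 < n)%N && ~~ odd n}.

Definition Zspace : Type := {n : pos_even & Mspace (val n)}.

(* The triangle inequality fails: M_8 has diameter 8 ^ 8 / 2 = 2 ^ 23, while
   its points lie at distance 4 ^ (2 + 8) = 2 ^ 20 from those of M_2. *)
Definition zeta (u v : Zspace) : R :=
  if tag u == tag v then dinf (tagged u) (tagged_as u v)
  else 4 ^+ (val (tag u) + val (tag v))%N.

End enflo.

(* Main.v *)
(* Enflo's averaging argument.  Suppose that [B] has roundness exponent
   [p > 0].  Identify [M_n] with the group [G = (Z / N) ^ K], [N = n ^ (2 n)],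
   [K = n ^ n], and for [v] in [G] let [Phi v] be the sum of
   [d (f u, f (u + v o s)) ^ p] over all [u] in [G] and all permutations [s] of
   the coordinates.  Then [Phi] inherits the roundness inequality and depends
   on [v] only up to permutation.  Let [w (r, S)] be a vector with [S] entries
   [r], [S] entries [- r] and zeros elsewhere.  Take [2 m] disjoint blocks of
   [g] coordinates, and let [x_i] (resp. [y_j]) be [- r] on the first (resp.
   last) [m] blocks, except for the value [r] on the [i]-th (resp. [j]-th) of
   them.  Up to permutation, all differences [x_j - x_i] and [y_j - y_i] are
   [w (2 r, g)] and all differences [y_j - x_i] are [w (r, m g)], whence
   [(m - 1) Phi (w (2 r, g)) <= m Phi (w (r, m g))].  Iterating [t] times with
   [m = 2 t] loses only a factor [(m / (m - 1)) ^ t <= 2] while the scale grows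
   from [2 ^ - t] to [1]: the modulus of continuity of [f] at scale [2 ^ - t]
   controls [f] at scale [1], where the inverse of [f] keeps images apart. *)

Require Import Defs.
From HB Require Import structures.
From mathcomp Require Import all_boot all_order all_algebra perm.
From mathcomp Require Import all_classical all_reals all_analysis.
From mathcomp Require Import zify lra.

Set Implicit Arguments.
Unset Strict Implicit.
Unset Printing Implicit Defensive.

Import Order.TTheory GRing.Theory Num.Theory.

Local Open Scope ring_scope.

(** * Blocks of coordinates, and sign patterns up to permutation *)

Lemma disjoint_blocks (K m g : nat) : (2 * m * g <= K)%N ->
  exists (U : bool -> {set 'I_K}) (X : bool -> 'I_m -> {set 'I_K}),
  [/\ [disjoint U false & U true], forall b, #|U b| = (m * g)%N,
      forall b i, X b i \subset U b, forall b i, #|X b i| = g &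
      forall b i j, i != j -> [disjoint X b i & X b j]].
Proof.
(* [J] addresses a coordinate by side, block and position; every set below is the image of a product
   under one injection into ['I_K]. *)
pose J : finType := (bool * ('I_m * 'I_g))%type.
move=> leK; have cardJ : #|J| = (2 * m * g)%N.
  by rewrite card_prod card_bool card_prod !card_ord mulnA.
have leJ : (#|J| <= K)%N by rewrite cardJ.
pose e (x : J) : 'I_K := widen_ord leJ (enum_rank x).
have e_inj : injective e.
  by move=> x y /(congr1 val)/= /val_inj/enum_rank_inj.
exists (fun b => e @: finset.setX [set b] (finset.setTfor ('I_m * 'I_g)%type)).
exists (fun b i => e @:
  finset.setX [set b] (finset.setX [set i] (finset.setTfor 'I_g))).
split=> [|b|b i|b i|b i j neij] /=.
- rewrite -finset.setI_eq0 -finset.imsetI; last by move=> *; apply: e_inj.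
  apply/eqP/finset.setP=> k; rewrite inE; apply/imsetP=> -[[b x]].
  by rewrite !inE !andbT => /andP[/eqP ->].
- by rewrite card_imset// cardsX cards1 mul1n cardsT card_prod !card_ord.
- by apply: imsetS; apply: finset.setXS => //; apply: finset.subsetT.
- by rewrite card_imset// !cardsX !cards1 !mul1n cardsT card_ord.
- rewrite -finset.setI_eq0 -finset.imsetI; last by move=> *; apply: e_inj.
  apply/eqP/finset.setP=> k; rewrite inE; apply/imsetP=> -[[c [x y]]].
  rewrite !inE !andbT => /andP[/andP[_ /eqP ->] /andP[_ /eqP eij] _].
  by rewrite eij eqxx in neij.
Qed.

(** For disjoint [A] and [B] of cardinal [S], this is the vector [w (r, S)] of the outline. *)
Definition signed_pattern (Z : zmodType) (K : nat) (r : Z)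
    (A B : {set 'I_K}) : {ffun 'I_K -> Z} :=
  [ffun k => if k \in A then r else if k \in B then - r else 0].

Lemma count_signed_pattern (Z : zmodType) (K : nat) (r : Z)
    (A B : {set 'I_K}) (a : pred Z) : [disjoint A & B] ->
  count a [tuple signed_pattern r A B k | k < K] =
  (#|A| * a r + #|B| * a (- r)%R + (K - (#|A| + #|B|)) * a 0%R)%N.
Proof.
move=> dAB.
have -> : count a [tuple signed_pattern r A B k | k < K] =
    (\sum_(k < K) a (signed_pattern r A B k))%N.
  by rewrite -sum1_count big_mkcond/= big_map big_enum/=; apply: eq_bigr.
rewrite (bigID [in A])/= (bigID [in B] (fun k => k \notin A))/= addnA.
congr (_ + _ + _)%N.
- rewrite -sum_nat_const; apply: eq_bigr => k kA.
  by rewrite ffunE kA.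
- rewrite -sum_nat_const; apply: eq_big => [k|k /andP[/negbTE kA kB]].
    by case: (boolP (k \in B)) => kB; rewrite ?andbF ?andbT// (disjointFl dAB).
  by rewrite ffunE kA kB.
- rewrite -[X in (X - _)%N](card_ord K)
    -(eqP (etrans (leq_card_setU A B).2 dAB))//.
  rewrite -(cardsC (finset.setU A B)) addKn -sum_nat_const.
  apply: eq_big => [k|k /andP[/negbTE kA /negbTE kB]].
    by rewrite !inE negb_or.
  by rewrite ffunE kA kB.
Qed.

(** The counts of all predicates determine a tuple up to permutation, and here they depend only on
    [r] and the cardinals of the two sets. *)
Lemma signed_pattern_perm (Z : zmodType) (K : nat) (r : Z)
    (A B A' B' : {set 'I_K}) :
  [disjoint A & B] -> [disjoint A' & B'] -> #|A| = #|A'| -> #|B| = #|B'| ->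
  exists s : {perm 'I_K},
    forall k, signed_pattern r A B k = signed_pattern r A' B' (s k).
Proof.
move=> dAB dAB' cA cB.
have /tuple_permP[s es] : perm_eq [tuple signed_pattern r A B k | k < K]
    [tuple signed_pattern r A' B' k | k < K].
  by apply/seq.permP => a; rewrite !count_signed_pattern// cA cB.
exists s => k.
have /(congr1 (fun t => tnth t k)) := val_inj es.
by rewrite !tnth_mktuple.
Qed.

Lemma exchange_big4 (V : nmodType) (S U I J : finType) (P : I -> pred J)
    (F : S -> U -> I -> J -> V) :
  \sum_s \sum_u \sum_i \sum_(j | P i j) F s u i j =
  \sum_i \sum_(j | P i j) \sum_s \sum_u F s u i j.
Proof.
under eq_bigr do rewrite exchange_big /=.
rewrite exchange_big /=; apply: eq_bigr => i _.
under eq_bigr do rewrite exchange_big /=.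
by rewrite exchange_big.
Qed.

(** * Sums over translations and coordinate permutations *)

Section averaging.
Variables (R : realType) (Z : finZmodType) (K : nat).
Local Notation G := {ffun 'I_K -> Z}.
Variable D : G -> G -> R.

(** This is [Phi] of the outline for a general kernel [D]. It is not normalised, so the number of
    terms reappears as [M] in the final estimate. *)
Definition average (v : G) : R :=
  \sum_(s : {perm 'I_K}) \sum_(u : G) D u (u + [ffun k => v (s k)]).

Lemma average_perm (v w : G) (s : {perm 'I_K}) :
  (forall k, v k = w (s k)) -> average v = average w.
Proof.
move=> vw; rewrite [RHS](reindex_inj (mulIg s)) /=.
apply: eq_bigr => t _; apply: eq_bigr => u _; congr (D u (u + _)).
by apply/ffunP => k; rewrite !ffunE vw permM.
Qed.

(** Translating [u] by the permuted [a] makes each term a value of [D] at two moved points, so that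
    roundness applies for each fixed [s] and [u]. *)
Lemma average_sub (a b : G) : average (b - a) =
  \sum_(s : {perm 'I_K}) \sum_(u : G)
    D (u + [ffun k => a (s k)]) (u + [ffun k => b (s k)]).
Proof.
apply: eq_bigr => s _.
rewrite (reindex_inj (addIr [ffun k => a (s k)])) /=.
apply: eq_bigr => u _; congr (D _ _).
by apply/ffunP => k; rewrite !ffunE -addrA subrKC.
Qed.

Variable m : nat.
Hypothesis roundD : forall x y : 'I_m -> G,
  \sum_(i < m) \sum_(j < m | (i < j)%N) (D (x i) (x j) + D (y i) (y j))
  <= \sum_(i < m) \sum_(j < m) D (x i) (y j).

Lemma average_roundness (x y : 'I_m -> G) :
  \sum_(i < m) \sum_(j < m | (i < j)%N)
     (average (x j - x i) + average (y j - y i))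
  <= \sum_(i < m) \sum_(j < m) average (y j - x i).
Proof.
pose T (z : G) (s : {perm 'I_K}) (u : G) : G := u + [ffun k => z (s k)].
under eq_bigr do under eq_bigr do rewrite !average_sub -big_split/=.
under [leRHS]eq_bigr do under eq_bigr do rewrite average_sub.
under eq_bigr do under eq_bigr do under eq_bigr do rewrite -big_split/=.
rewrite -(exchange_big4 (fun i j : 'I_m => (i < j)%N)).
rewrite -(exchange_big4 (fun _ _ : 'I_m => true)).
apply: ler_sum => s _; apply: ler_sum => u _.
exact: (roundD (fun i => T (x i) s u) (fun i => T (y i) s u)).
Qed.

Lemma average_doubling (g : nat) (r : Z) (A B : {set 'I_K}) :
  (1 < m)%N -> [disjoint A & B] -> #|A| = (m * g)%N -> #|B| = (m * g)%N ->
  exists A' B' : {set 'I_K}, [/\ [disjoint A' & B'], #|A'| = g, #|B'| = g &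
    m.-1%:R * average (signed_pattern (r *+ 2) A' B')
      <= m%:R * average (signed_pattern r A B)].
Proof.
move=> m_gt1 dAB cA cB.
have leK : (2 * m * g <= K)%N.
  rewrite -mulnA mul2n -addnn -{1}cA -cB.
  rewrite -(eqP (etrans (leq_card_setU A B).2 dAB)) -[leqRHS]card_ord.
  exact: max_card.
have [U [X [dU cU sXU cX dX]]] := disjoint_blocks leK.
(* The families [x false] and [x true] are the [x_i] and [y_j] of the outline. *)
pose x b i := signed_pattern r (X b i) (U b :\: X b i).
have in_U b i k : k \in X b i -> k \in U b by apply/fintype.subsetP.
have xx b i j : i != j ->
    x b j - x b i = signed_pattern (r *+ 2) (X b j) (X b i).
  move=> neij; apply/ffunP => k; rewrite !ffunE !inE.
  have := disjointFr (dX b i j neij) (x := k).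
  have := @in_U b i k; have := @in_U b j k.
  case: (k \in X b i) => [_ /(_ erefl) -> /(_ erefl) ->|] /=.
    by rewrite -opprD mulr2n.
  case: (k \in X b j) => [/(_ erefl) -> _ _|_ _ _]/=.
    by rewrite opprK mulr2n.
  by rewrite subrr.
pose i0 := Ordinal (ltnW m_gt1); pose i1 := Ordinal m_gt1.
exists (X false i1), (X false i0); split; rewrite ?cX ?dX//.
have disU k : ~~ ((k \in U false) && (k \in U true)).
  by apply/negP => /andP[/(disjointFr dU) ->].
(* The value [r] comes from one block of [x true j] and from the [m - 1] blocks where [x false i] is
   [- r], hence on [m g] coordinates; likewise for [- r]. *)
have yx i j : average (x true j - x false i) = average (signed_pattern r A B).
  set P := X true j :|: (U false :\: X false i).
  set Q := X false i :|: (U true :\: X true j).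
  have eqD : x true j - x false i = signed_pattern r P Q.
    apply/ffunP => k; rewrite !ffunE !inE.
    have := @in_U true j k; have := @in_U false i k; have := disU k.
    case: (k \in X false i); case: (k \in X true j);
      case: (k \in U false); case: (k \in U true) => //= _;
      rewrite ?subr0 ?add0r ?opprK ?oppr0//;
      by [move=> /(_ erefl)|move=> _ /(_ erefl)].
  have dPQ : [disjoint P & Q].
    apply/pred0P => k; rewrite /= !inE; apply/negbTE.
    have := @in_U true j k; have := @in_U false i k; have := disU k.
    case: (k \in X false i); case: (k \in X true j);
      case: (k \in U false); case: (k \in U true) => //= _;
      by [move=> /(_ erefl)|move=> _ /(_ erefl)].
  have cardUD b b' a a' : b != b' ->
      #|X b a :|: (U b' :\: X b' a')| = (m * g)%N.
    move=> neb; rewrite (eqP (etrans (leq_card_setU _ _).2 _)).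
      rewrite cardsDS// cX cU cX subnKC// leq_pmull//.
      exact: ltnW.
    apply/pred0P => k; rewrite /= !inE; apply/negbTE.
    have := @in_U b a k; have := disU k.
    case: (k \in X b a) => //= /[swap] /(_ erefl).
    by case: b b' neb => -[]//= _ ->; rewrite /= ?andbT => /negbTE->;
      rewrite andbF.
  have [||s es] := signed_pattern_perm r dPQ dAB.
  - by rewrite cA cardUD.
  - by rewrite cB cardUD.
  by rewrite eqD; apply: average_perm es.
pose v := average (signed_pattern (r *+ 2) (X false i1) (X false i0)).
have xxv b i j : i != j -> average (x b j - x b i) = v.
  move=> neij; rewrite xx//.
  have [||||s es] := @signed_pattern_perm _ _ (r *+ 2) (X b j) (X b i)
    (X false i1) (X false i0); rewrite ?cX ?dX// 1?eq_sym//.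
  exact: average_perm es.
have := average_roundness (x false) (x true).
under [leRHS]eq_bigr do under eq_bigr do rewrite yx.
rewrite (eq_bigr (fun i : 'I_m => \sum_(j < m | (i < j)%N) (v + v)));
  last first.
  by move=> i _; apply: eq_bigr => j ij; rewrite !xxv// -val_eqE/= ltn_eqF.
(* The ['C(m, 2)] pairs contribute [2 v] each, so the left side is [m (m - 1) v]; the right side has
   [m ^ 2] equal terms, and one factor [m] cancels. *)
rewrite (exchange_big_dep xpredT)//=.
under eq_bigr => j _.
  rewrite -(big_ord_widen _ (fun=> v + v) (ltnW (ltn_ord j))).
  rewrite sumr_const card_ord.
  over.
rewrite -mulr2n sumrMnr -(big_mkord xpredT id) bin2_sum -mulrnA.
rewrite -(mul_bin_diag m 1) bin1 !sumr_const card_ord -mulrnA mulnC.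
by rewrite !mulr_natl !mulrnA lerMn2r -[m == 0%N]negbK -lt0n (ltnW m_gt1).
Qed.

Lemma average_iterated_doubling (t : nat) (r : Z) (A B : {set 'I_K}) :
  (1 < m)%N -> [disjoint A & B] -> #|A| = (m ^ t)%N -> #|B| = (m ^ t)%N ->
  exists A' B' : {set 'I_K}, [/\ [disjoint A' & B'], #|A'| = 1%N, #|B'| = 1%N &
    m.-1%:R ^+ t * average (signed_pattern (r *+ 2 ^ t) A' B')
      <= m%:R ^+ t * average (signed_pattern r A B)].
Proof.
move=> m_gt1; elim: t r A B => [|t IHt] r A B dAB cA cB.
  by exists A, B; rewrite !expr0 !mul1r expn0 mulr1n.
rewrite expnS in cA cB.
have [A1 [B1 [dAB1 cA1 cB1 le1]]] := average_doubling r m_gt1 dAB cA cB.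
have [A2 [B2 [dAB2 cA2 cB2 le2]]] := IHt (r *+ 2) A1 B1 dAB1 cA1 cB1.
exists A2, B2; split=> //.
rewrite expnS mulrnA exprS -mulrA.
apply: le_trans (ler_wpM2l (ler0n _ _) le2) _.
by rewrite mulrCA exprSr -mulrA ler_wpM2l// exprn_ge0.
Qed.
End averaging.

(** * The points of [M_n] as vectors of residues modulo [N] *)

Section grid.
Variables (R : realType) (n : nat).
Hypothesis n_gt1 : (1 < n)%N.

Local Notation N := (n ^ (2 * n))%N.
Local Notation Z := 'I_N.-1.+1.

Let n_gt0 : (0 < n)%N. Proof. exact: ltnW. Qed.

Let N_prednK : N.-1.+1 = N.
Proof. by rewrite prednK// expn_gt0 n_gt0. Qed.

Let nn_gt0 : 0 < n%:R ^+ n :> R.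
Proof. by rewrite exprn_gt0// ltr0n. Qed.

Lemma grid_subproof (a : Z) : (a.+1%:R * n%:R ^- n : R) \in Lset (R := R) n.
Proof.
apply/mem_set; exists a.+1; split=> //.
by rewrite lez_nat -[leqRHS]N_prednK.
Qed.

(** The shift by one matches residues starting at [0] with numerators starting at [1]. *)
Definition grid (a : Z) : Lset (R := R) n := SigSub (grid_subproof a).

(** The coordinates are [s] steps apart, or [N - s] if the sum wraps around; as [n ^ n] is [N]
    steps, [chi] takes the minimum of the two in either case. *)
Lemma chi_gridD (a s : Z) :
  chi n (val (grid a)) (val (grid (a + s))) =
  (minn s (N - s))%:R * n%:R ^- n.
Proof.
have ltsN : (s < N)%N by rewrite -[ltnRHS]N_prednK.
have NE : N%:R * n%:R ^- n = n%:R ^+ n :> R.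
  by rewrite mul2n -addnn expnD natrM natrX mulfK// gt_eqF.
have dist (x y w : R) : 0 <= w -> y - x = w \/ x - y = w -> `|x - y| = w.
  by move=> w0 [e|e]; [rewrite distrC|]; rewrite e ger0_norm.
have absE : `|val (grid a) - val (grid (a + s))| = s%:R * n%:R ^- n \/
    `|val (grid a) - val (grid (a + s))| = (N - s)%:R * n%:R ^- n.
  have [lt|le] := ltnP (a + s) N; [left|right]; apply: dist => /=.
  - by rewrite mulr_ge0// invr_ge0 ltW.
  - left; rewrite [X in (_ %% X)%N]N_prednK modn_small// -mulrBl -natrB;
      last by lia.
    by congr (_%:R * _); lia.
  - by rewrite mulr_ge0// invr_ge0 ltW.
  - right; rewrite [X in (_ %% X)%N]N_prednK.
    have aN : (a < N)%N by rewrite -[ltnRHS]N_prednK.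
    have -> : ((a + s) %% N = a + s - N)%N.
      by rewrite -[in LHS](subnK le) modnDr modn_small//; lia.
    by rewrite -mulrBl -natrB; [congr (_%:R * _)|]; lia.
rewrite /chi; set w := `|_| in absE *.
have -> : (minn s (N - s))%:R * n%:R ^- n =
    Num.min (s%:R * n%:R ^- n) ((N - s)%:R * n%:R ^- n) :> R.
  by rewrite natr_min minr_pMl// invr_ge0 ltW.
have subE k : (k <= N)%N ->
    n%:R ^+ n - k%:R * n%:R ^- n = (N - k)%:R * n%:R ^- n :> R.
  by move=> leN; rewrite -[X in X - _]NE -mulrBl -natrB.
case: absE => ->; rewrite subE ?leq_subr//; first exact: ltnW.
by rewrite subKn 1?minC; last exact: ltnW.
Qed.

Lemma chi_grid_pm (a s : Z) (r : nat) : (2 * r <= N)%N ->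
  s \in [:: inZp r; - inZp r] ->
  chi n (val (grid a)) (val (grid (a + s))) = r%:R * n%:R ^- n.
Proof.
move=> leN s_r; rewrite chi_gridD; congr (_%:R * _).
have N_gt0 : (0 < N)%N by rewrite expn_gt0 n_gt0.
have ltrN : (r < N)%N by lia.
move: s_r; rewrite !inE => /orP[] /eqP -> /=; rewrite N_prednK.
  by rewrite modn_small//; lia.
rewrite (modn_small ltrN); have [->|r0] := posnP r.
  by rewrite subn0 modnn; lia.
by rewrite modn_small; lia.
Qed.

Definition grid_point (u : {ffun 'I_(n ^ n) -> Z}) : Mspace R n :=
  [ffun k => grid (u k)].

Lemma dinf_grid_le (u v : {ffun 'I_(n ^ n) -> Z}) (r : nat) :
  (2 * r <= N)%N ->
  (forall k, v k \in [:: inZp r; - inZp r; 0]) ->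
  dinf (grid_point u) (grid_point (u + v)) <= r%:R * n%:R ^- n.
Proof.
move=> leN hv; rewrite /dinf; apply: bigmax_le => [|k _].
  by rewrite mulr_ge0// invr_ge0 ltW.
rewrite !ffunE; have := hv k; rewrite !inE orbA => /orP[vk|/eqP ->].
  by rewrite (@chi_grid_pm _ _ r)// !inE.
rewrite addr0 /chi subrr normr0 subr0 min_l; last exact: ltW.
by rewrite mulr_ge0// invr_ge0 ltW.
Qed.

Lemma dinf_grid_ge (u v : {ffun 'I_(n ^ n) -> Z}) (r : nat) (k : 'I_(n ^ n)) :
  (2 * r <= N)%N -> v k = inZp r ->
  r%:R * n%:R ^- n <= dinf (grid_point u) (grid_point (u + v)).
Proof.
move=> leN vk; rewrite /dinf.
apply: le_trans (le_bigmax _ _ k).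
by rewrite !ffunE vk (@chi_grid_pm _ _ r)// mem_head.
Qed.

End grid.

(** * Choice of the scales and the final estimate *)

Lemma zeta_Tagged (R : realType) (n : pos_even) (x y : Mspace R (val n)) :
  zeta (Tagged (fun n : pos_even => Mspace R (val n)) x)
       (Tagged (fun n : pos_even => Mspace R (val n)) y) = dinf x y.
Proof. by rewrite /zeta eqxx tagged_asE. Qed.

(* Bernoulli's inequality [1 - j / m <= (1 - 1 / m) ^ j], without division. *)
Lemma bernoulli_nat (m j : nat) : (j <= m)%N ->
  (m ^ j * (m - j) <= m.-1 ^ j * m)%N.
Proof.
elim: j => [|j IHj] ltjm; first by rewrite subn0.
have {}IHj := IHj (ltnW ltjm).
rewrite !expnS; apply: (@leq_trans (m ^ j * (m - j) * m.-1)).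
  rewrite [(m * _)%N]mulnC -!mulnA leq_mul2l; apply/orP; right.
  nia.
by rewrite [(m.-1 * _)%N]mulnC [leqRHS]mulnAC leq_mul2r IHj orbT.
Qed.

Theorem theorem4p1 (R : realType) (B : metricType R)
    (hB : (0 < generalized_roundness (fun x y : B => mdist x y))%E) :
  ~ exists f : Zspace R -> B,
      uniform_embedding (@zeta R) (fun x y : B => mdist x y) f.
Proof.
case=> f [f_inj f_uc [g fgK g_uc]].
have [_ [p [_ p_round] <-]] := ereal_sup_gt hB; rewrite lte_fin => p_gt0.
(* Contrapositive of the uniform continuity of [g] at tolerance [1]. *)
have [c c_gt0 sepf] : exists2 c : R, 0 < c &
    forall u v, 1 <= zeta u v -> c <= mdist (f u) (f v).
  have [c c_gt0 hc] := g_uc 1 ltr01.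
  exists c => // u v uv; rewrite leNgt; apply/negP => ltc.
  have fr w : f w \in range f by apply/mem_set; exists w.
  have gK w : g (SigSub (fr w)) = w by apply: f_inj; rewrite fgK.
  have := hc (SigSub (fr u)) (SigSub (fr v)) ltc.
  by rewrite !gK ltNge uv.
(* Chosen so that [e ^ p = c ^ p / 4], which beats the loss of a factor [2]. *)
pose e := c * 4^-1 `^ p^-1.
have e_gt0 : 0 < e by rewrite mulr_gt0// powR_gt0// invr_gt0.
have eE : e `^ p = c `^ p / 4.
  rewrite powRM ?powR_ge0 ?(ltW c_gt0)// -powRrM mulVf ?gt_eqF//.
  by rewrite powRr1// invr_ge0.
have [d d_gt0 hd] := f_uc e e_gt0.
have [t t_gt0 td] : exists2 t, (0 < t)%N & (2 ^+ t)^-1 < d.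
  exists (Num.truncn d^-1).+1 => //.
  rewrite invf_plt ?posrE ?exprn_gt0//.
  apply: lt_trans (truncnS_gt _) _.
  by rewrite -natrX ltr_nat ltn_expl.
(* With [m = 2 t], Bernoulli's inequality at [t] loses a factor [2]. With [n = 4 t], [2 ^ t] divides
   [n ^ n] and two sets of [m ^ t] coordinates fit, as [2 ^ t * m ^ t = n ^ t]. *)
pose m := (2 * t)%N; pose n := (4 * t)%N.
have n_even : ((0 < n) && ~~ odd n)%N by rewrite oddM muln_gt0 t_gt0.
pose ne : pos_even := exist _ n n_even.
have n_gt1 : (1 < n)%N by rewrite /n; lia.
have m_gt1 : (1 < m)%N by rewrite /m; lia.
have t2_dvd : (2 ^ t %| n ^ n)%N.
  have -> : (n ^ n = 2 ^ t * ((2 * t) ^ t * n ^ (3 * t)))%N.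
    by rewrite mulnA -expnMn mulnA -expnD; congr (_ ^ _)%N; rewrite /n; lia.
  exact: dvdn_mulr.
(* In steps of [n ^ - n], [r] is the distance [2 ^ - t], and [t] doublings lead to [n ^ n] steps,
   the distance [1]. *)
pose r := (n ^ n %/ 2 ^ t)%N.
have rE : (r * 2 ^ t = n ^ n)%N by rewrite divnK.
have nn_gt1 : (1 < n ^ n)%N by rewrite -[1%N](exp1n n) ltn_exp2r// ltnW.
have nn_le : (2 * n ^ n <= n ^ (2 * n))%N.
  by rewrite [(2 * n)%N]mul2n -addnn expnD leq_mul2r nn_gt1 orbT.
have r_le : (2 * r <= n ^ (2 * n))%N.
  apply: leq_trans nn_le; rewrite leq_mul2l/=.
  by rewrite -rE leq_pmulr// expn_gt0.
have rR : r%:R * n%:R ^- n = (2 ^+ t)^-1 :> R.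
  rewrite -natrX -rE natrM natrX invfM mulrA divff ?mul1r//.
  by rewrite pnatr_eq0; apply: contraTneq nn_gt1 => r0; rewrite -rE r0.
pose h u : Zspace R :=
  Tagged (fun k : pos_even => Mspace R (val k))
    (grid_point R n_gt1 u : Mspace R (val ne)).
pose D u v := mdist (f (h u)) (f (h v)) `^ p.
have D_round x y := p_round m (f \o h \o x) (f \o h \o y) m_gt1.
have mt_le : (2 * 1 * m ^ t <= n ^ n)%N.
  apply: (@leq_trans (2 ^ t * m ^ t)).
    by rewrite muln1 leq_mul2r (leq_pexp2l (n1 := 1))// orbT.
  rewrite -expnMn mulnA leq_exp2l//.
  exact: leq_pmull.
(* One block of [m ^ t] coordinates per side gives the initial pattern. *)
have [U [_ [dU cU _ _ _]]] := disjoint_blocks mt_le.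
have {}cU b : #|U b| = (m ^ t)%N by rewrite cU mul1n.
have [A [A' [dA cA _ leA]]] :=
  @average_iterated_doubling _ _ _ D m D_round t (inZp r) _ _ m_gt1
    dU (cU _) (cU _).
pose G := {ffun 'I_(n ^ n) -> 'I_(n ^ (2 * n)).-1.+1}.
pose M := (#|G| * #|{perm 'I_(n ^ n)}|)%N.
have sum_cst (a : R) : \sum_(s : {perm 'I_(n ^ n)}) \sum_(u : G) a = a *+ M.
  by under eq_bigr do rewrite sumr_const; rewrite sumr_const -mulrnA.
have M_gt0 : (0 < M)%N.
  rewrite muln_gt0; apply/andP.
  by split; apply/fintype.card_gt0P; [exists 0 | exists 1%g].
have upper : average D (signed_pattern (inZp r) (U false) (U true))
    <= e `^ p *+ M.
  rewrite -sum_cst; apply: ler_sum => s _; apply: ler_sum => u _.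
  rewrite ge0_ler_powR ?nnegrE ?mdist_ge0 ?(ltW p_gt0) ?(ltW e_gt0)//.
  apply/ltW/hd; rewrite zeta_Tagged.
  apply: le_lt_trans (@dinf_grid_le R n n_gt1 _ _ r r_le _) _.
    move=> k; rewrite !ffunE !inE; case: ifP => _; first by rewrite eqxx.
    by case: ifP => _; rewrite eqxx ?orbT.
  by rewrite rR.
have lower : c `^ p *+ M <= average D (signed_pattern (inZp r *+ 2 ^ t) A A').
  rewrite -sum_cst; apply: ler_sum => s _; apply: ler_sum => u _.
  rewrite ge0_ler_powR ?nnegrE ?mdist_ge0 ?(ltW p_gt0) ?(ltW c_gt0)//.
  apply: sepf; rewrite zeta_Tagged.
  (* The single coordinate in [A] already forces distance at least [1]. *)
  have /fintype.card_gt0P[k kA] : (0 < #|A|)%N by rewrite cA.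
  have := @dinf_grid_ge R _ n_gt1 u
    [ffun k => signed_pattern (inZp r *+ 2 ^ t) A A' (s k)] _
    ((s^-1)%g k) nn_le.
  rewrite natrX mulfV ?gt_eqF ?exprn_gt0 ?ltr0n ?(ltnW n_gt1)//; apply.
  by rewrite !ffunE permKV kA Zp_mulrn; apply: val_inj; rewrite /= modnMml rE.
have := le_trans (ler_wpM2l (exprn_ge0 t (ler0n _ m.-1)) lower)
  (le_trans leA (ler_wpM2l (exprn_ge0 t (ler0n _ m)) upper)).
apply/negP; rewrite -ltNge eE.
have bern : m%:R ^+ t <= 2 * m.-1%:R ^+ t :> R.
  rewrite -!natrX -natrM ler_nat.
  have tm : (t <= m)%N by apply: leq_pmull.
  have mt : (m - t = t)%N by rewrite /m mul2n -addnn addnK.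
  have le_t := bernoulli_nat tm; rewrite mt in le_t.
  rewrite -(leq_pmul2r t_gt0); apply: leq_trans le_t _.
  by rewrite -mulnA mulnCA.
rewrite -mulrnAl.
have X_gt0 : 0 < c `^ p *+ M by rewrite pmulrn_rgt0// powR_gt0.
have Y_gt0 : 0 < m.-1%:R ^+ t :> R.
  by rewrite exprn_gt0// ltr0n -ltnS prednK// ltnW.
(* The negated goal would give [X Y <= m ^ t X / 4 <= X Y / 2] with [X Y > 0]. *)
set X := c `^ p *+ M in X_gt0 *; set Y := m.-1%:R ^+ t in Y_gt0 bern *.
have XY_gt0 := mulr_gt0 X_gt0 Y_gt0.
have WX_le := ler_wpM2r (ltW X_gt0) bern.
clear -XY_gt0 WX_le; lra.
Qed.
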